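(* Let $S=\begin{bmatrix} S_{11} & S_{12}\\ S_{21} & S_{22}\end{bmatrix}$ be an arbitrary real $2n\times 2n$ matrix with $n\times n$ blocks $S_{ij}$. Put $S^{(0)}=S$ and, for $i=1,\ldots,n-1$, let $U_i$ be the matrix constructed from $S^{(i-1)}$ as described in the context and $S^{(i)}=U_i^{-1}S^{(i-1)}U_i$. Assume that at every step $i=1,\ldots,n-1$ the condition $$\sum_{j=i+1}^{n} t_{ji}\,r_{ji}\neq 0$$ holds, where $r_{jk}$ and $t_{jk}$ denote the entries of the $(1,1)$ block and of the $(2,1)$ block of $S^{(i-1)}$, respectively. Then the global transformation matrix $U=U_1U_2\cdots U_{n-1}$ has the form $$U=\begin{bmatrix} L & 0\\ YL & L^{-\mathrm T}\end{bmatrix},\qquad Y^{\mathrm T}=Y,$$ with $L$ invertible, where the first row and the first column of $Y$ are equal to zero, and the transformed matrix $S'=U^{-1}SU=\begin{bmatrix} S'_{11} & S'_{12}\\ S'_{21} & S'_{22}\end{bmatrix}$ is such that $S'_{11}$ is an upper Hessenberg matrix and $S'_{21}$ is an upper triangular matrix.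
   Context: All matrices are real; $L^{-\mathrm T}=(L^{-1})^{\mathrm T}$. The $i$-th column of an $n\times n$ matrix $(a_{jk})$ is called upper triangular if $a_{ji}=0$ for $j>i$, and Hessenberg if $a_{ji}=0$ for $j>i+1$; a matrix is upper triangular (upper Hessenberg) if all its columns are. Construction of $U_i$ from $S^{(i-1)}$ (step $i$, $1\le i\le n-1$). Write $r_{jk}$ for the entries of the $(1,1)$ block and $t_{jk}$ for the entries of the $(2,1)$ block of $S^{(i-1)}$, and suppose $\sum_{j=i+1}^n t_{ji}r_{ji}\ne 0$. Set $$U_i=\begin{bmatrix} L_i & 0\\ Y_iL_i & L_i^{-\mathrm T}\end{bmatrix},$$ where: (1) $Y_i=\alpha\, v v^{\mathrm T}$, with $v=(0,\ldots,0,t_{i+1,i},\ldots,t_{n,i})^{\mathrm T}$ (first $i$ entries zero) and $\alpha=1/\sum_{j=i+1}^n t_{ji}r_{ji}$. (2) If the $i$-th column of the $(1,1)$ block is already Hessenberg, $L_i=I_n$. Otherwise choose $k\in\{i+1,\ldots,n\}$ with $|r_{ki}|$ maximal among $|r_{i+1,i}|,\ldots,|r_{n,i}|$, let $P$ be the permutation matrix interchanging the indices $k$ and $i+1$ ($P=I_n$ if $k=i+1$), let $(\tilde r_{1},\ldots,\tilde r_{n})^{\mathrm T}=P\,(r_{1i},\ldots,r_{ni})^{\mathrm T}$ (which is the $i$-th column of the $(1,1)$ block after interchanging both its rows and its columns $k$ and $i+1$), and put $L_i=P L'$, where $L'$ is the identity matrix except that its $(j,i+1)$ entry is $w_j=\tilde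 r_{j}/\tilde r_{i+1}$ for $j=i+2,\ldots,n$. *)

(* Defs.v *)
From HB Require Import structures.
From mathcomp Require Import all_boot all_order all_algebra.

Set Implicit Arguments.
Unset Strict Implicit.
Unset Printing Implicit Defensive.

Import Order.TTheory GRing.Theory Num.Theory.
Local Open Scope ring_scope.

(* Rows and columns are numbered from 0, elimination steps from 1: step i
   (1 <= i <= n - 1) treats the column of index i - 1. *)

Definition upper_triangular_col (R : realFieldType) (n : nat)
    (A : 'M[R]_n) (i : 'I_n) : bool :=
  [forall j : 'I_n, (i < j)%N ==> (A j i == 0)].

Definition hessenberg_col (R : realFieldType) (n : nat)
    (A : 'M[R]_n) (i : 'I_n) : bool :=
  [forall j : 'I_n, (i.+1 < j)%N ==> (A j i == 0)].

Definition upper_triangular_mx (R : realFieldType) (n : nat)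
    (A : 'M[R]_n) : bool :=
  [forall i : 'I_n, upper_triangular_col A i].

Definition upper_hessenberg_mx (R : realFieldType) (n : nat)
    (A : 'M[R]_n) : bool :=
  [forall i : 'I_n, hessenberg_col A i].

Definition pivot_sum (R : realFieldType) (n : nat)
    (S : 'M[R]_(n + n)) (i : 'I_n) : R :=
  \sum_(j < n | (i < j)%N) dlsubmx S j i * ulsubmx S j i.

Definition step_v (R : realFieldType) (n : nat)
    (S : 'M[R]_(n + n)) (i : 'I_n) : 'cV[R]_n :=
  \col_j (if (i < j)%N then dlsubmx S j i else 0).

Definition step_Y (R : realFieldType) (n : nat)
    (S : 'M[R]_(n + n)) (i : 'I_n) : 'M[R]_n :=
  (pivot_sum S i)^-1 *: (step_v S i *m (step_v S i)^T).

(* The matrix L' built from the permuted column r~ and the pivot position p. *)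
Definition gauss_mx (R : realFieldType) (n : nat)
    (r : 'cV[R]_n) (p : 'I_n) : 'M[R]_n :=
  \matrix_(j, l) (if (l == p) && (p < j)%N then r j 0 / r p 0
                  else (j == l)%:R).

(* A relation rather than a function, because the index k of an entry of
   maximal modulus need not be unique. Only used when i.+1 < n, in which case
   the cyclic successor ordS i has value i.+1. *)
Definition step_L (R : realFieldType) (n : nat)
    (A : 'M[R]_n) (i : 'I_n) (L : 'M[R]_n) : Prop :=
  if hessenberg_col A i then L = 1%:M
  else exists k : 'I_n,
    [/\ (i < k)%N,
        forall j : 'I_n, (i < j)%N -> `|A j i| <= `|A k i| &
        L = tperm_mx k (ordS i)
              *m gauss_mx (tperm_mx k (ordS i) *m col i A) (ordS i)].

Definition step_U (R : realFieldType) (n : nat)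
    (S : 'M[R]_(n + n)) (i : 'I_n) (U : 'M[R]_(n + n)) : Prop :=
  exists2 L : 'M[R]_n,
    step_L (ulsubmx S) i L &
    U = block_mx L 0 (step_Y S i *m L) (invmx L)^T.

(* Main.v *)
Require Import Defs.
From HB Require Import structures.
From mathcomp Require Import all_boot all_order all_algebra.

Set Implicit Arguments.
Unset Strict Implicit.
Unset Printing Implicit Defensive.

Import Order.TTheory GRing.Theory Num.Theory.
Local Open Scope ring_scope.

(** Write [A] and [C] for the left blocks of [S], and [e_c] for the basis
    vectors.  Every [U_i] lies in the group of matrices
    [[L, 0], [Y L, L^-T]] with [Y] symmetric; the product formula is
    [symp_ltrig_mul].  Since [U^-1 (x, y) = (L^-1 x, L^T (y - Y x))], whenever
    [L e_c = e_c] and [Y e_c = 0] the left column [c] of [U^-1 S U] has halves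
    [L^-1 A e_c] and [L^T (C e_c - Y A e_c)] ([col_conj_symp_ltrig]): only
    these two vectors have to be understood.

    In the step that treats column [i], both [L] and [L^T] fix
    [e_0, ..., e_i], and [Y = v v^T / (v^T A e_i)], where [v] is the part of
    [C e_i] below the diagonal.  Three things follow.
    - For a finished column [c < i], [A e_c] is supported on the first
      [c + 2 <= i + 1] coordinates, where [v] vanishes; so [Y A e_c = 0], and
      [L^-1], [L^T] leave both halves of the column as they are.
    - For [c = i] the scaling of [Y] gives [Y A e_i = v], so subtracting it
      clears [C e_i] below the diagonal.
    - [L^-1] is one step of Gaussian elimination with pivoting and makes
      [A e_i] Hessenberg; the pivot is nonzero, being an entry of maximal
      modulus in a column that is not Hessenberg yet.
    So step [i] finishes column [i] and preserves the earlier ones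
    ([step_reduced]), and after [n - 1] steps only the last column remains, on
    which there is no condition.  As every step fixes [e_0], so does the
    product, which gives the zero first column of [Y]; the first row follows
    by symmetry. *)

(** Square matrix multiplication as a monoid law, for peeling off the last
    factor of an iterated product. *)
HB.instance Definition _ (R : pzSemiRingType) (n : nat) :=
  Monoid.isLaw.Build 'M[R]_n 1%:M mulmx
    (@mulmxA R n n n n) (@mul1mx R n n) (@mulmx1 R n n).

(** * Vectors supported on leading coordinates *)

Definition leading (R : realFieldType) n (m : nat) (x : 'cV[R]_n) : Prop :=
  forall j : 'I_n, (m <= j)%N -> x j 0 = 0.

Definition fixes_leading (R : realFieldType) n (m : nat) (L : 'M[R]_n) : Prop :=
  forall x : 'cV[R]_n, leading m x -> L *m x = x.

Section Leading.
Variables (R : realFieldType) (n : nat).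
Implicit Types (A L : 'M[R]_n) (x : 'cV[R]_n) (c : 'I_n).

Lemma hessenberg_colP A c :
  reflect (leading c.+2 (col c A)) (hessenberg_col A c).
Proof.
apply: (iffP forallP) => [h j cj|h j].
  by move/implyP: (h j) => /(_ cj)/eqP; rewrite mxE.
by apply/implyP => cj; move: (h j cj); rewrite mxE => ->.
Qed.

Lemma upper_triangular_colP A c :
  reflect (leading c.+1 (col c A)) (upper_triangular_col A c).
Proof.
apply: (iffP forallP) => [h j cj|h j].
  by move/implyP: (h j) => /(_ cj)/eqP; rewrite mxE.
by apply/implyP => cj; move: (h j cj); rewrite mxE => ->.
Qed.

Lemma leading_le m p x : (m <= p)%N -> leading m x -> leading p x.
Proof. by move=> mp hx j pj; apply: hx; apply: leq_trans pj. Qed.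

Lemma leading_delta c : leading c.+1 (delta_mx c 0 : 'cV[R]_n).
Proof. by move=> j; rewrite mxE andbT; case: eqP => // ->; rewrite ltnn. Qed.

Lemma fixes_leading1 m : fixes_leading m (1%:M : 'M[R]_n).
Proof. by move=> x _; rewrite mul1mx. Qed.

Lemma fixes_leadingM m L1 L2 : fixes_leading m L1 -> fixes_leading m L2 ->
  fixes_leading m (L1 *m L2).
Proof. by move=> h1 h2 x hx; rewrite -mulmxA h2 // h1. Qed.

Lemma fixes_leadingV m L : L \in unitmx -> fixes_leading m L ->
  fixes_leading m (invmx L).
Proof. by move=> uL hL x hx; rewrite -{1}(hL x hx) mulKmx. Qed.

End Leading.

(** * The group of transformations *)

Definition symp_ltrig (R : realFieldType) n (L Y : 'M[R]_n) : 'M[R]_(n + n) :=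
  block_mx L 0 (Y *m L) (invmx L)^T.

Section SympLtrig.
Variables (R : realFieldType) (n : nat).
Implicit Types (L Y : 'M[R]_n) (S : 'M[R]_(n + n)).

Lemma invmx_mul (L1 L2 : 'M[R]_n) : L1 \in unitmx -> L2 \in unitmx ->
  invmx (L1 *m L2) = invmx L2 *m invmx L1.
Proof.
move=> u1 u2; apply: (can_inj (mulKmx (_ : L1 *m L2 \in unitmx))).
  by rewrite unitmx_mul u1.
by rewrite mulmxV ?unitmx_mul ?u1 // mulmxA -(mulmxA L1) mulmxV // mulmx1 mulmxV.
Qed.

Lemma symp_ltrig_unit L Y : L \in unitmx -> symp_ltrig L Y \in unitmx.
Proof.
move=> uL; rewrite unitmxE det_lblock unitrM -!unitmxE uL /=.
by rewrite unitmx_tr unitmx_inv.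
Qed.

Lemma symp_ltrig_mul L1 Y1 L2 Y2 : L1 \in unitmx -> L2 \in unitmx ->
  symp_ltrig L1 Y1 *m symp_ltrig L2 Y2 =
  symp_ltrig (L1 *m L2) (Y1 + (invmx L1)^T *m Y2 *m invmx L1).
Proof.
move=> u1 u2; rewrite /symp_ltrig mulmx_block !mul0mx !mulmx0 !addr0 add0r.
rewrite invmx_mul // trmx_mul; congr block_mx.
by rewrite mulmxDl !mulmxA (mulmxKV u1).
Qed.

Lemma invmx_symp_ltrig L Y : L \in unitmx ->
  invmx (symp_ltrig L Y) = block_mx (invmx L) 0 (- (L^T *m Y)) L^T.
Proof.
move=> uL.
apply: (can_inj (mulKmx (symp_ltrig_unit Y uL))).
rewrite mulmxV ?symp_ltrig_unit // mulmx_block !mul0mx !mulmx0 !addr0 add0r.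
rewrite mulmxN !mulmxA mulmxK // -trmx_mul (mulmxV uL) trmx1 mul1mx subrr.
by rewrite scalar_mx_block.
Qed.

(** Conjugating by [symp_ltrig L Y] involves the right blocks of [S] only
    through [Y]; on a column that [Y] kills and [L] fixes they drop out. *)
Lemma col_conj_symp_ltrig S L Y (c : 'I_n) : L \in unitmx ->
  let S' := invmx (symp_ltrig L Y) *m S *m symp_ltrig L Y in
  L *m delta_mx c 0 = delta_mx c 0 :> 'cV_n ->
  Y *m delta_mx c 0 = 0 :> 'cV_n ->
  col c (ulsubmx S') = invmx L *m col c (ulsubmx S) /\
  col c (dlsubmx S') =
    L^T *m (col c (dlsubmx S) - Y *m col c (ulsubmx S)).
Proof.
move=> uL S' hL hY.
have SE : S = block_mx (ulsubmx S) (ursubmx S) (dlsubmx S) (drsubmx S).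
  by rewrite submxK.
rewrite {}/S' {1 3}SE invmx_symp_ltrig // /symp_ltrig.
rewrite -!mulmxA !mulmx_block block_mxKul block_mxKdl !mul0mx !addr0 !colE.
have fixU (M N : 'M[R]_n) :
    (M *m L + N *m (Y *m L)) *m delta_mx c 0 = M *m delta_mx c 0 :> 'cV_n.
  by rewrite mulmxDl -!mulmxA hL hY mulmx0 addr0.
split; first by rewrite -mulmxA fixU.
by rewrite mulmxDl -!mulmxA !fixU mulNmx mulmxBr !mulmxA addrC.
Qed.

End SympLtrig.

(** * The elimination factor [L] *)

Section StepL.
Variables (R : realFieldType) (n : nat).
Implicit Types (A L : 'M[R]_n) (r x : 'cV[R]_n) (i p : 'I_n).

Lemma gauss_mx_unit r p : gauss_mx r p \in unitmx.
Proof.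
rewrite unitmxE det_trig.
  rewrite big1 ?unitr1 // => j _; rewrite mxE eqxx.
  by case: eqP => // ->; rewrite ltnn.
apply/is_trig_mxP => j l jl; rewrite mxE.
case: eqP => [lp|_] /=; last by rewrite -val_eqE ltn_eqF.
by rewrite -lp ltnNge (ltnW jl) /= -val_eqE ltn_eqF.
Qed.

Lemma gauss_mx_mul r p x j :
  (gauss_mx r p *m x) j 0 =
    x j 0 + (if (p < j)%N then r j 0 / r p 0 * x p 0 else 0).
Proof.
rewrite mxE; under eq_bigr => l _ do rewrite mxE.
case: ltnP => pj.
  have jp : j != p by rewrite -val_eqE gtn_eqF.
  rewrite (bigD1 j) //= (bigD1 p) /=; last by rewrite eq_sym.
  rewrite (negbTE jp) eqxx mul1r /= big1 ?addr0 ?eqxx // => l /andP[lj lp].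
  by rewrite (negbTE lp) /= eq_sym (negbTE lj) mul0r.
rewrite (bigD1 j) //= andbF eqxx mul1r big1 // => l lj.
by rewrite andbF eq_sym (negbTE lj) mul0r.
Qed.

Lemma fixes_leading_gauss r p : fixes_leading p (gauss_mx r p).
Proof.
move=> x hx; apply/colP => j; rewrite gauss_mx_mul (hx p) // mulr0.
by case: ifP; rewrite addr0.
Qed.

Lemma fixes_leading_gauss_tr r p : fixes_leading p (gauss_mx r p)^T.
Proof.
move=> x hx; apply/colP => j; rewrite mxE (bigD1 j) //= !mxE eqxx.
have -> : (j == p) && (p < j)%N = false.
  by case: eqP => // ->; rewrite ltnn.
rewrite mul1r big1 ?addr0 // => l lj; rewrite !mxE.
have [pl|lp] := leqP p l; first by rewrite hx ?mulr0.
by rewrite (ltnNge p) (ltnW lp) andbF (negbTE lj) mul0r.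
Qed.

(** Solving [gauss_mx r p *m y = r] amounts to truncating [r] below the
    pivot. *)
Lemma leading_gauss_inv r p : r p 0 != 0 ->
  leading p.+1 (invmx (gauss_mx r p) *m r).
Proof.
move=> rp; pose y : 'cV[R]_n := \col_j (if (j <= p)%N then r j 0 else 0).
have rE : gauss_mx r p *m y = r.
  apply/colP => j; rewrite gauss_mx_mul !mxE leqnn (ltnNge p).
  by case: leqP => _ /=; rewrite ?addr0 // add0r divfK.
suff -> : invmx (gauss_mx r p) *m r = y by move=> j pj; rewrite mxE leqNgt pj.
by rewrite -{2}rE mulKmx // gauss_mx_unit.
Qed.

Lemma fixes_leading_tperm m (k p : 'I_n) : (m <= k)%N -> (m <= p)%N ->
  fixes_leading m (tperm_mx k p : 'M[R]_n).
Proof.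
move=> mk mp x hx; rewrite -xrowE; apply/colP => j; rewrite mxE.
by case: perm.tpermP => [->|->|//]; rewrite !hx.
Qed.

Lemma step_LP A i L : (i.+1 < n)%N -> step_L A i L ->
  [/\ L \in unitmx, fixes_leading i.+1 L, fixes_leading i.+1 L^T &
      leading i.+2 (invmx L *m col i A)].
Proof.
move=> iN; rewrite /step_L; case: hessenberg_colP => [hA ->|hA [k [ik kmax ->]]].
  rewrite unitmx1 trmx1 invmx1 mul1mx.
  by split=> //; apply: fixes_leading1.
have pE : ordS i = i.+1 :> nat by rewrite /= modn_small.
set p := ordS i in pE *; set r := tperm_mx k p *m col i A.
have uP : (tperm_mx k p : 'M[R]_n) \in unitmx by apply: unitmx_perm.
have uG := gauss_mx_unit r p.
have fP : fixes_leading i.+1 (tperm_mx k p : 'M[R]_n).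
  by apply: fixes_leading_tperm; rewrite // pE.
have rp : r p 0 != 0.
  (* A zero pivot, being the largest entry, would make the column
     Hessenberg. *)
  rewrite /r -xrowE !mxE perm.tpermR; apply/eqP => Ak0; apply: hA => j ij.
  have := kmax j (ltnW ij).
  by rewrite Ak0 normr0 normr_le0 mxE => /eqP.
split.
- by rewrite unitmx_mul uP.
- by apply: fixes_leadingM => //; rewrite -pE; apply: fixes_leading_gauss.
- rewrite trmx_mul tr_tperm_mx; apply: fixes_leadingM => //.
  by rewrite -pE; apply: fixes_leading_gauss_tr.
rewrite invmx_mul // -mulmxA -pE.
have -> : invmx (tperm_mx k p) *m col i A = r.
  apply: (can_inj (mulKmx uP)); rewrite mulKVmx // mulmxA -perm_mxM.
  by rewrite perm.tperm2 perm_mx1 mul1mx.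
exact: leading_gauss_inv.
Qed.

End StepL.

(** * One elimination step *)

Section Step.
Variables (R : realFieldType) (n : nat).
Implicit Types (S U : 'M[R]_(n + n)) (i c : 'I_n) (x : 'cV[R]_n).

Definition reduced_col S c : Prop :=
  leading c.+2 (col c (ulsubmx S)) /\ leading c.+1 (col c (dlsubmx S)).

Lemma step_Y_tr S i : (step_Y S i)^T = step_Y S i.
Proof. by rewrite /step_Y linearZ /= trmx_mul trmxK. Qed.

Lemma step_Y_mul_leading S i x : leading i.+1 x -> step_Y S i *m x = 0.
Proof.
move=> hx; rewrite /step_Y -scalemxAl -mulmxA.
suff -> : (step_v S i)^T *m x = 0 by rewrite mulmx0 scaler0.
apply/matrixP => a b; rewrite !mxE big1 // => j _; rewrite !mxE ord1.
by case: ltnP => [ij|_]; rewrite ?mul0r // hx ?mulr0.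
Qed.

(** The pivot sum is [v^T A e_i], so [v v^T / (v^T A e_i)] sends [A e_i]
    to [v]. *)
Lemma step_Y_mul_pivot S i : pivot_sum S i != 0 ->
  step_Y S i *m col i (ulsubmx S) = step_v S i.
Proof.
move=> hp; rewrite /step_Y -scalemxAl -mulmxA.
have -> : (step_v S i)^T *m col i (ulsubmx S) = (pivot_sum S i)%:M.
  apply/matrixP => a b; rewrite !ord1 mxE mxE /= mulr1n.
  rewrite /pivot_sum [RHS]big_mkcond /=; apply: eq_bigr => j _.
  by rewrite !mxE; case: ifP => _; rewrite ?mul0r.
by rewrite mul_mx_scalar scalerA mulVf // scale1r.
Qed.

(** Fixing [e_0] is part of the invariant because the [Y]-part of a product is
    [Y1 + L1^-T Y2 L1^-1]: its first column vanishes as soon as those of [Y1]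
    and [Y2] do and [L1 e_0 = e_0]. *)
Definition good_transform U : Prop := exists L Y : 'M[R]_n,
  [/\ U = symp_ltrig L Y, L \in unitmx, Y^T = Y, fixes_leading 1 L &
      forall x, leading 1 x -> Y *m x = 0].

Lemma good_transform_unit U : good_transform U -> U \in unitmx.
Proof. by case=> [L [Y [-> uL _ _ _]]]; apply: symp_ltrig_unit. Qed.

Lemma good_transform1 : good_transform 1%:M.
Proof.
exists 1%:M, 0; split; rewrite ?unitmx1 ?trmx0 //.
- by rewrite /symp_ltrig mul0mx invmx1 trmx1 -scalar_mx_block.
- exact: fixes_leading1.
- by move=> x _; rewrite mul0mx.
Qed.

Lemma good_transform_mul U1 U2 :
  good_transform U1 -> good_transform U2 -> good_transform (U1 *m U2).
Proof.
move=> [L1 [Y1 [-> u1 s1 f1 z1]]] [L2 [Y2 [-> u2 s2 f2 z2]]].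
exists (L1 *m L2), (Y1 + (invmx L1)^T *m Y2 *m invmx L1); split.
- exact: symp_ltrig_mul.
- by rewrite unitmx_mul u1.
- by rewrite raddfD /= !trmx_mul trmxK s1 s2 mulmxA.
- exact: fixes_leadingM.
- move=> x hx; rewrite mulmxDl z1 // -!mulmxA (fixes_leadingV u1 f1 hx).
  by rewrite z2 // mulmx0 addr0.
Qed.

Lemma step_good S i U : (i.+1 < n)%N -> step_U S i U -> good_transform U.
Proof.
move=> iN [L /(step_LP iN)[uL fL _ _] ->].
exists L, (step_Y S i); split=> //; first exact: step_Y_tr.
- by move=> x hx; apply: fL; apply: leading_le hx.
- by move=> x hx; apply: step_Y_mul_leading; apply: leading_le hx.
Qed.

Lemma step_reduced S i U c : (i.+1 < n)%N -> step_U S i U ->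
  pivot_sum S i != 0 ->
  (forall c : 'I_n, (c < i)%N -> reduced_col S c) ->
  (c <= i)%N -> reduced_col (invmx U *m S *m U) c.
Proof.
move=> iN [L /(step_LP iN)[uL fL fLT hL] ->] hp IH ci.
have le_c : leading i.+1 (delta_mx c 0 : 'cV[R]_n).
  by apply: (@leading_le _ _ c.+1) => //; apply: leading_delta.
have [] := col_conj_symp_ltrig S uL (fL _ le_c) (step_Y_mul_leading S le_c).
rewrite /symp_ltrig /reduced_col => -> ->.
move: ci; rewrite leq_eqVlt => /orP[/eqP/val_inj -> | ci].
  split=> //; rewrite step_Y_mul_pivot //.
  have hC : leading i.+1 (col i (dlsubmx S) - step_v S i).
    by move=> j ij; rewrite !mxE ij subrr.
  by rewrite fLT.
have [hA hC] := IH c ci.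
rewrite step_Y_mul_leading ?subr0; last exact: leading_le hA.
rewrite (fixes_leadingV uL fL) ?fLT //.
- by apply: leading_le hC; apply: leqW.
- exact: leading_le hA.
Qed.

End Step.

(** * The full reduction *)

Theorem theorem2p1 (R : realFieldType) (n : nat) (S : 'M[R]_(n + n))
    (S_ U_ : nat -> 'M[R]_(n + n))
    (hS0 : S_ 0%N = S)
    (hU : forall i : 'I_n, (i.+1 < n)%N -> step_U (S_ i) i (U_ i.+1))
    (hS : forall i : 'I_n, (i.+1 < n)%N ->
            S_ i.+1 = invmx (U_ i.+1) *m S_ i *m U_ i.+1)
    (hpivot : forall i : 'I_n, (i.+1 < n)%N -> pivot_sum (S_ i) i != 0) :
  let U : 'M[R]_(n + n) := \big[mulmx/1%:M]_(1 <= i < n) U_ i in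
  let S' : 'M[R]_(n + n) := invmx U *m S *m U in
  (exists L Y : 'M[R]_n,
     [/\ U = block_mx L 0 (Y *m L) (invmx L)^T,
         Y^T = Y,
         L \in unitmx,
         forall i j : 'I_n, i = 0%N :> nat -> Y i j = 0 &
         forall i j : 'I_n, j = 0%N :> nat -> Y i j = 0]) /\
  upper_hessenberg_mx (ulsubmx S') /\
  upper_triangular_mx (dlsubmx S').
Proof.
move=> U S'.
have main m : (m.+1 <= n)%N ->
    let V : 'M[R]_(n + n) := \big[mulmx/1%:M]_(1 <= i < m.+1) U_ i in
    [/\ good_transform V, S_ m = invmx V *m S *m V &
        forall c : 'I_n, (c < m)%N -> reduced_col (S_ m) c].
  elim: m => [|m IH] mn V.
    rewrite /V big_geq //; split=> //; first exact: good_transform1.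
    by rewrite invmx1 mul1mx mulmx1.
  have [gV SE red] := IH (ltnW mn).
  pose i := Ordinal (ltnW mn).
  have gU : good_transform (U_ m.+1) by apply: step_good (hU i mn).
  rewrite /V big_nat_recr //=; split.
  - exact: good_transform_mul.
  - rewrite (hS i mn) /= SE invmx_mul ?good_transform_unit //.
    by rewrite !mulmxA.
  - move=> c cm; rewrite (hS i mn) /=.
    exact: (@step_reduced _ _ (S_ m) i _ c mn (hU i mn) (hpivot i mn) red).
have [gU red] : good_transform U /\ forall c : 'I_n, reduced_col S' c.
  rewrite /S' /U; case: n => [|m] in S S_ U_ hS0 hU hS hpivot U S' main *.
    by rewrite big_geq //; split; [exact: good_transform1 | case].
  have [gV <- red] := main m (leqnn _); split=> // c.
  have [/red //|mc] := ltnP c m.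
  (* The last column has no entry below its diagonal. *)
  by split=> j cj; move: (ltn_ord j); rewrite ltnS leqNgt => /negP[];
    apply: leq_trans cj; rewrite ?ltnS // ltnW.
split; last first.
  split; apply/forallP => c; have [hA hC] := red c.
    exact/hessenberg_colP.
  exact/upper_triangular_colP.
have [L [Y [UE uL sY _ zY]]] := gU.
have col0 (i j : 'I_n) : j = 0%N :> nat -> Y i j = 0.
  move=> j0; have /zY/colP/(_ i) : leading 1 (delta_mx j 0 : 'cV[R]_n).
    by rewrite -{1}j0; apply: leading_delta.
  by rewrite -colE !mxE.
exists L, Y; split=> // i j i0.
by rewrite -sY mxE col0.
Qed.
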